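(* Let $r,n,a$ be positive integers. Then for every integer $k$ with $1\le k\le n$, $$\sum_{j=1}^{n}\binom{r-1+j}{n}\sum_{b=1}^{j}(-1)^{j-b}\binom{n+1}{j-b}\binom{ab+k-1}{n}=\binom{ar+n-k}{n}.$$
   Context: For non-negative integers $m,n$, $\binom{m}{n}$ is the usual binomial coefficient, with $\binom{m}{n}=0$ when $m<n$. *)

(* Defs.v *)
From mathcomp Require Export all_boot all_order all_algebra.

(* Main.v *)
(** The polynomial f(x) = C(ax+k-1, n) has degree at most n, so
    (1-t)^(n+1) * sum_b f(b) t^b is a polynomial sum_j A_j t^j of degree at most n, and
    f(x) = sum_j A_j C(x+n-j, n): both sides are polynomials of degree at most n,
    and they agree at x = 0, ..., n.  The inner sum of the statement is A_j (the
    b = 0 term vanishes because k <= n), and evaluating at x = -r with the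
    reflection C(-y, n) = (-1)^n C(y+n-1, n) on both sides gives the identity. *)
Require Import Defs.
From mathcomp Require Import all_boot all_order all_algebra.
From mathcomp Require Import ring zify.

Import GRing.Theory.

Local Open Scope ring_scope.

(** This is n! * C(x, n), left undivided so that all coefficients stay integers. *)
Definition falling_poly (n : nat) : {poly int} := \prod_(i < n) ('X - (i%:Z)%:P).

(** The coefficient of t^j in (1-t)^(n+1) * sum_b f(b) t^b. *)
Definition worpitzky_coef (n : nat) (f : nat -> int) (j : nat) : int :=
  \sum_(0 <= b < j.+1) (-1) ^+ (j - b) * 'C(n.+1, j - b)%:Z * f b.

Lemma horner_falling_poly n x : (falling_poly n).[x] = \prod_(i < n) (x - i%:Z).
Proof. by rewrite horner_prod; apply: eq_bigr => i _; rewrite !hornerE. Qed.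

Lemma size_falling_poly n : size (falling_poly n) = n.+1.
Proof. by rewrite /falling_poly -big_enum size_prod_XsubC size_enum_ord. Qed.

Lemma falling_poly_nat n m : (falling_poly n).[m%:Z] = ('C(m, n) * n`!)%N%:Z.
Proof.
rewrite horner_falling_poly bin_ffact ffact_prod.
have [lt_mn | le_nm] := ltnP m n.
  rewrite (bigD1 (Ordinal lt_mn)) //= subrr mul0r.
  by rewrite (bigD1 (Ordinal lt_mn)) //= subnn mul0n.
rewrite (big_morph Posz PoszM (erefl 1%:Z)).
by apply: eq_bigr => i _; have := ltn_ord i; lia.
Qed.

(** Reversing the order of the factors turns x - i into x - (n-1-i) = -((n-1-x) - i), so each of the
    n factors yields a sign. *)
Lemma falling_poly_reflect n x :
  (falling_poly n).[x] = (-1) ^+ n * (falling_poly n).[n%:Z - 1 - x].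
Proof.
rewrite !horner_falling_poly [in RHS](reindex_inj rev_ord_inj) /=.
rewrite -[n in (-1) ^+ n]card_ord -prodr_const -big_split /=.
by apply: eq_bigr => i _; have := ltn_ord i; lia.
Qed.

(* The coefficient of [t^m] in [(1-t)^(n+1) * (1-t)^-(n+1)]. *)
Lemma alternating_bin_convolution n m :
  \sum_(0 <= i < m.+1) (-1) ^+ i * 'C(n.+1, i)%:Z * 'C(m - i + n, n)%:Z
  = (m == 0%N)%:Z.
Proof.
elim: n => [|n IHn].
  case: m => [|m]; first by rewrite big_nat1.
  rewrite big_ltn // big_ltn // big_nat big1 ?addr0 => [|i /andP[i_gt1 _]].
    by rewrite !bin0.
  by rewrite [in 'C(1, i)]bin_small // mulr0 mul0r.
rewrite -{}IHn; case: m => [|m]; first by rewrite !big_nat1 !bin0 !subnn !add0n !binn.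
rewrite big_ltn // [X in _ + X]big_add1 /=.
(* Pascal's rule on the first binomial: (1-t)^(n+2) = (1-t) * (1-t)^(n+1). *)
have -> : \sum_(0 <= i < m.+1)
    (-1) ^+ i.+1 * 'C(n.+2, i.+1)%:Z * 'C(m.+1 - i.+1 + n.+1, n.+1)%:Z =
  \sum_(0 <= i < m.+1)
    (-1) ^+ i.+1 * 'C(n.+1, i.+1)%:Z * 'C(m.+1 - i.+1 + n.+1, n.+1)%:Z -
  \sum_(0 <= i < m.+1)
    (-1) ^+ i * 'C(n.+1, i)%:Z * 'C(m - i + n.+1, n.+1)%:Z.
  rewrite -sumrB; apply: eq_bigr => i _.
  by rewrite subSS [in 'C(n.+2, _)]binS PoszD exprS; ring.
(* Pascal's rule on the second binomial: (1-t)^-(n+1) = (1-t) * (1-t)^-(n+2). Both sides thus become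
   the same difference. *)
have -> : \sum_(0 <= i < m.+2)
    (-1) ^+ i * 'C(n.+1, i)%:Z * 'C(m.+1 - i + n, n)%:Z =
  \sum_(0 <= i < m.+2)
    (-1) ^+ i * 'C(n.+1, i)%:Z * 'C(m.+1 - i + n.+1, n.+1)%:Z -
  \sum_(0 <= i < m.+1)
    (-1) ^+ i * 'C(n.+1, i)%:Z * 'C(m - i + n.+1, n.+1)%:Z.
  rewrite big_nat_recr // [in RHS]big_nat_recr //= subnn !add0n !binn addrAC.
  congr (_ + _); rewrite -sumrB; apply: eq_big_nat => i /andP[_ lt_im].
  by rewrite subSn // !addSn addnS [in 'C(_.+2, _)]binS PoszD; ring.
by rewrite [in RHS]big_ltn // [in RHS]big_add1 /= !bin0 addrA.
Qed.

(** Multiplying back by (1-t)^-(n+1) recovers the generating series of f: after exchanging the sums,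
    the convolution above keeps only b = s. No polynomiality of f enters. *)
Lemma worpitzky_nat n (f : nat -> int) s :
  \sum_(0 <= j < s.+1) worpitzky_coef n f j * 'C(s - j + n, n)%:Z = f s.
Proof.
pose F j b := (-1) ^+ (j - b) * 'C(n.+1, j - b)%:Z * f b * 'C(s - j + n, n)%:Z.
transitivity (\sum_(0 <= j < s.+1) \sum_(0 <= b < s.+1 | (b < j.+1)%N) F j b).
  apply: eq_big_nat => j /andP[_ lt_js].
  by rewrite mulr_suml (big_nat_widen _ _ s.+1).
rewrite (exchange_big_dep_nat xpredT) //=.
have inner b : (b < s.+1)%N ->
    \sum_(0 <= j < s.+1 | (b < j.+1)%N) F j b = f b * (s - b == 0)%N%:Z.
  move=> lt_bs; rewrite -(alternating_bin_convolution n) mulr_sumr.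
  transitivity (\sum_(b <= j < s.+1) F j b).
    by rewrite (big_nat_widenl b 0).
  rewrite -{1}[b]add0n big_addn subSn //.
  apply: eq_big_nat => i /andP[_ lt_i]; rewrite /F addnK.
  by rewrite [(i + b)%N]addnC subnDA; ring.
rewrite big_nat_recr //= inner // subnn mulr1 big_nat big1 ?add0r //.
move=> b /andP[_ lt_bs]; rewrite inner; last exact: ltnW.
by rewrite subn_eq0 leqNgt lt_bs mulr0.
Qed.

Lemma poly_worpitzky n (p : {poly int}) x : (size p <= n.+1)%N ->
  n`!%:Z * p.[x] = \sum_(0 <= j < n.+1)
    worpitzky_coef n (fun b => p.[b%:Z]) j * (falling_poly n).[x + n%:Z - j%:Z].
Proof.
move=> size_p; pose A := worpitzky_coef n (fun b => p.[b%:Z]).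
pose shifted j := falling_poly n \Po ('X + (n%:Z - j%:Z)%:P).
have shiftedE j y : (shifted j).[y] = (falling_poly n).[y + n%:Z - j%:Z].
  by rewrite horner_comp !hornerE; congr (_.[_]); ring.
pose q := n`!%:Z *: p - \sum_(0 <= j < n.+1) A j *: shifted j.
have qE y : q.[y] = n`!%:Z * p.[y] -
    \sum_(0 <= j < n.+1) A j * (falling_poly n).[y + n%:Z - j%:Z].
  rewrite hornerD hornerN hornerZ horner_sum; congr (_ - _).
  by apply: eq_bigr => j _; rewrite hornerZ shiftedE.
suff q0 : q = 0 by apply/eqP; rewrite -subr_eq0 -qE q0 horner0.
have size_q : (size q <= n.+1)%N.
  rewrite (leq_trans (size_polyD _ _)) // geq_max size_polyN.
  rewrite (leq_trans (size_scale_leq _ _)) //=.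
  rewrite (leq_trans (size_sum _ _ _)) //; apply/bigmax_leqP_seq => j _ _.
  rewrite (leq_trans (size_scale_leq _ _)) //.
  by rewrite size_comp_poly2 ?size_falling_poly // size_XaddC.
(* The n+1 points 0, ..., n are more roots than a nonzero polynomial of degree at most n can
   have. *)
pose rs := map Posz (iota 0 n.+1).
apply: (@roots_geq_poly_eq0 _ q rs); last by rewrite size_map size_iota.
- apply/allP => y /mapP[s + ->]; rewrite mem_iota add0n => /andP[_ lt_sn].
  rewrite /root qE subr_eq0 -(worpitzky_nat n (fun b => p.[b%:Z]) s) mulr_sumr.
  (* The terms with s < j <= n vanish, since then 0 <= s + n - j < n; the others form the sum of
     [worpitzky_nat]. *)
  rewrite [eqbRHS](big_cat_nat _ (n := s.+1)) //= [X in _ + X]big_nat.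
  rewrite [X in _ + X]big1 => [|j /andP[lt_sj lt_jn]].
    rewrite addr0; apply/eqP/eq_big_nat => j /andP[_ lt_js].
    have -> : s%:Z + n%:Z - j%:Z = (s - j + n)%N%:Z by lia.
    by rewrite falling_poly_nat PoszM; ring.
  have -> : s%:Z + n%:Z - j%:Z = (s + n - j)%N%:Z by lia.
  by rewrite falling_poly_nat bin_small ?mulr0 //; lia.
- by rewrite map_inj_uniq ?iota_uniq // => i j [].
Qed.

Theorem proposition1p4 (r n a : nat) (hr : (0 < r)%N) (hn : (0 < n)%N)
    (ha : (0 < a)%N) (k : nat) (hk1 : (1 <= k)%N) (hkn : (k <= n)%N) :
  \sum_(1 <= j < n.+1)
     ('C(r - 1 + j, n)%:Z *
      \sum_(1 <= b < j.+1)
         (-1) ^+ (j - b) * 'C(n.+1, j - b)%:Z * 'C(a * b + k - 1, n)%:Z)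
  = 'C(a * r + n - k, n)%:Z.
Proof.
pose p := falling_poly n \Po (a%:Z *: 'X + (k%:Z - 1)%:P).
have pE x : p.[x] = (falling_poly n).[a%:Z * x + (k%:Z - 1)].
  by rewrite horner_comp !hornerE.
have size_p : (size p <= n.+1)%N.
  rewrite size_comp_poly2 ?size_falling_poly //.
  by rewrite -mul_polyC size_MXaddC polyC_eq0 size_polyC; case: (a) ha.
have nfact_neq0 : n`!%:Z != 0 by rewrite eqz_nat -lt0n fact_gt0.
have p_nat b : p.[b%:Z] = 'C(a * b + k - 1, n)%:Z * n`!%:Z.
  have -> : p.[b%:Z] = (falling_poly n).[(a * b + k - 1)%N%:Z].
    by rewrite pE; congr (_.[_]); nia.
  by rewrite falling_poly_nat PoszM.
(* At b = 0 the upper index is k - 1 < n, so the inner sums may start at b = 1. *)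
have p0 : p.[0%N%:Z] = 0 by rewrite p_nat muln0 add0n bin_small ?mul0r //; lia.
have coefE j : worpitzky_coef n (fun b => p.[b%:Z]) j =
    n`!%:Z * \sum_(1 <= b < j.+1)
      (-1) ^+ (j - b) * 'C(n.+1, j - b)%:Z * 'C(a * b + k - 1, n)%:Z.
  rewrite /worpitzky_coef big_ltn // p0 mulr0 add0r mulr_sumr.
  by apply: eq_bigr => b _; rewrite p_nat; ring.
have coef0 : worpitzky_coef n (fun b => p.[b%:Z]) 0 = 0.
  by rewrite coefE big_geq // mulr0.
have := @poly_worpitzky n p (- r%:Z) size_p.
rewrite pE falling_poly_reflect.
(* The truncated subtraction is exact because k <= n. *)
have -> : n%:Z - 1 - (a%:Z * - r%:Z + (k%:Z - 1)) = (a * r + n - k)%N%:Z by nia.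
rewrite falling_poly_nat PoszM big_ltn // coef0 mul0r add0r.
under eq_bigr => j _.
  rewrite coefE falling_poly_reflect.
  have -> : n%:Z - 1 - (- r%:Z + n%:Z - j%:Z) = (r - 1 + j)%N%:Z by lia.
  rewrite falling_poly_nat PoszM.
  over.
move=> eq_scaled.
(* Both sides of [eq_scaled] carry (-1)^n * (n!)^2: the sign comes from reflection, one n! from [p]
   replacing C(ax+k-1, n), the other from clearing the denominator of C(x+n-j, n). *)
apply: (mulfI nfact_neq0); apply: (mulfI nfact_neq0).
apply: (mulfI (negbT (signr_eq0 int n))).
transitivity (n`!%:Z * ((-1) ^+ n * ('C(a * r + n - k, n)%:Z * n`!%:Z))); last by ring.
by rewrite eq_scaled !mulr_sumr; apply: eq_bigr => j _; ring.
Qed.
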